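(* Suppose the $\mathbb{Z}^d$ system is ergodic and almost surely no walk $X_z$, $z\in\mathcal{W}(\omega)$, has a loop (i.e. $X_z(\omega,i)\ne X_z(\omega,j)$ for $i\ne j$). Then $(\mathcal{S},\mathcal{F}_\alpha,\mathbb{P}_\alpha,T_\alpha)$ is a measure-preserving $\mathbb{Z}$-system: $T_\alpha$ restricted to $\mathcal{S}$ is, up to $\mathbb{P}_\alpha$-null sets, an invertible bimeasurable map of $\mathcal{S}$ onto itself, and $\mathbb{P}_\alpha(T_\alpha^{-1}\mathcal{E})=\mathbb{P}_\alpha(\mathcal{E})$ for every $\mathcal{E}\in\mathcal{F}_\alpha$.
   Context: $\mathbb{Z}^+=\{0,1,2,\dots\}$. $(\Omega,\mathcal{F},\mathbb{P},\{T^z\}_{z\in\mathbb{Z}^d})$ is a measure-preserving $\mathbb{Z}^d$ action on a probability space. $\mathcal{W}(\omega)\subset\mathbb{Z}^d$ is a measurable random set that is translation covariant, $\mathcal{W}(T^z\omega)=\mathcal{W}(\omega)-z$, with $\mathbb{P}(\mathbf{0}\in\mathcal{W})>0$. For $z\in\mathcal{W}(\omega)$, $X_z(\omega,\cdot):\mathbb{Z}^+\to\mathbb{Z}^d$ is a nearest-neighbor path with $X_z(\omega,0)=z$, measurable in $\omega$. Almost surely, for all $z\in\mathcal{W}(\omega)$, $x\in\mathbb{Z}^d$, $k\in\mathbb{Z}^+$, the walks are stationary, $X_z(\omega,k)=x+X_{z-x}(T^x\omega,k)$, and compatible, $X_z(\omega,k+1)=X_{X_z(\omega,1)}(\omega,k)$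 (in particular $X_z(\omega,1)\in\mathcal{W}(\omega)$). A point $z$ is bi-infinite if there is a sequence $(a_n)_{n\ge0}$ in $\mathcal{W}(\omega)$ with $a_0=z$ and $X_{a_n}(\omega,i)=a_{n-i}$ for all $n\ge 1$, $0\le i\le n$; the union $\bigcup_{n}\bigcup_{i\ge0}\{X_{a_n}(\omega,i)\}$ is called a bi-infinite trajectory. $\mathcal{S}=\{\omega:\mathbf{0}\in\mathcal{W}(\omega)\text{ and }\mathbf{0}\text{ is bi-infinite}\}$, $\mathcal{F}_\alpha$ is the trace of $\mathcal{F}$ on $\mathcal{S}$, and $\mathbb{P}_\alpha(\mathcal{A})=\mathbb{P}(\mathcal{A}\cap\mathcal{S})$ (not normalized). For $\omega$ with $\mathbf{0}\in\mathcal{W}(\omega)$ set $\alpha(\omega)=X_{\mathbf{0}}(\omega,1)\in\{\pm e_1,\dots,\pm e_d\}$ and $T_\alpha\omega=T^{\alpha(\omega)}\omega$. *)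

(* Defs.v *)
From HB Require Import structures.
From mathcomp Require Import all_boot all_order all_algebra.
From mathcomp Require Import all_classical all_reals all_analysis.

Set Implicit Arguments.
Unset Strict Implicit.
Unset Printing Implicit Defensive.

Import Order.TTheory GRing.Theory Num.Theory.
Import numFieldNormedType.Exports.

Local Open Scope classical_set_scope.
Local Open Scope ring_scope.

Notation lattice d := 'rV[int]_d.

Section Action.
Context {disp : measure_display} {Omega : measurableType disp} {R : realType}.
Variables (d : nat) (P : probability Omega R).
Implicit Type T : lattice d -> Omega -> Omega.

Definition mp_lattice_action T : Prop :=
  [/\ forall w, T 0 w = w,
      forall x y w, T (x + y) w = T x (T y w),
      forall z, measurable_fun setT (T z) &
      forall z (A : set Omega), measurable A -> P (T z @^-1` A) = P A].

Definition ergodic_action T : Prop :=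
  forall A : set Omega, measurable A ->
    (forall z, T z @^-1` A = A) -> P A = 0%E \/ P A = 1%E.

End Action.

(* The walks [X z w : nat -> lattice d] are total functions; the value of
   [X z w] is unconstrained when [z] is not in [W w], and every definition
   below only looks at walks started from points of [W w]. *)
Section Walks.
Context {disp : measure_display} {Omega : measurableType disp} {R : realType}.
Context {d : nat}.
Variables (P : probability Omega R) (T : lattice d -> Omega -> Omega).
Variables (W : Omega -> set (lattice d)).
Variables (X : lattice d -> Omega -> nat -> lattice d).

Definition measurable_random_set : Prop :=
  forall z, measurable [set w | W w z].

Definition covariant_set : Prop :=
  forall z w, W (T z w) = [set x - z | x in W w].

(* Measurability of w |-> X z w k on the event {z \in W}, where the lattice
   carries the discrete sigma-algebra. *)
Definition measurable_walks : Prop :=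
  forall z k (B : set (lattice d)),
    measurable ([set w | W w z] `&` (fun w => X z w k) @^-1` B).

Definition unit_step (v : lattice d) : Prop :=
  exists i : 'I_d, v = delta_mx 0 i \/ v = - delta_mx 0 i.

Definition nearest_neighbor_walks : Prop :=
  forall w z, W w z ->
    X z w 0%N = z /\ forall k, unit_step (X z w k.+1 - X z w k).

Definition stationary_walks : Prop :=
  {ae P, forall w, forall z x k, W w z ->
    X z w k = x + X (z - x) (T x w) k}.

Definition compatible_walks : Prop :=
  {ae P, forall w, forall z k, W w z ->
    W w (X z w 1%N) /\ X z w k.+1 = X (X z w 1%N) w k}.

Definition loop_free_walks : Prop :=
  {ae P, forall w, forall z, W w z ->
    forall i j : nat, i <> j -> X z w i <> X z w j}.

Definition bi_infinite (w : Omega) (z : lattice d) : Prop :=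
  exists a : nat -> lattice d,
    [/\ forall n, W w (a n), a 0%N = z &
        forall n i : nat, (1 <= n)%N -> (i <= n)%N ->
          X (a n) w i = a (n - i)%N].

Definition S_bi : set Omega := [set w | W w 0 /\ bi_infinite w 0].

Definition F_alpha : set (set Omega) := strace measurable S_bi.

Definition P_alpha (A : set Omega) : \bar R := P (A `&` S_bi).

Definition T_alpha (w : Omega) : Omega := T (X 0 w 1%N) w.

End Walks.

Section ZSystem.
Context {Omega : Type} {R : realType}.
Variables (S : set Omega) (F : set (set Omega)) (mu : set Omega -> \bar R).
Variable f : Omega -> Omega.

(* [sigma_algebra S F] alone does not say that the members of [F] are
   subsets of [S]. *)
Definition measure_space_on : Prop :=
  [/\ sigma_algebra S F, forall A, F A -> A `<=` S, mu set0 = 0%E,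
      forall A, F A -> (0 <= mu A)%E &
      forall A : nat -> set Omega, (forall n, F (A n)) -> trivIset setT A ->
        (fun n => (\sum_(0 <= i < n) mu (A i))%E) @ \oo --> mu (\bigcup_n A n)].

Definition invertible_bimeasurable_mod0 : Prop :=
  exists S0 : set Omega,
    [/\ F S0, mu (S `\` S0) = 0%E, set_bij S0 S0 f &
        forall E, F E -> F (S0 `&` f @^-1` E) /\ F (f @` (S0 `&` E))].

(* [f] is only relevant on [S], so the preimage of [E] is S `&` f @^-1` E. *)
Definition measure_preserving_on : Prop :=
  forall E, F E -> F (S `&` f @^-1` E) /\ mu (S `&` f @^-1` E) = mu E.

Definition mp_Z_system : Prop :=
  [/\ measure_space_on, invertible_bimeasurable_mod0 & measure_preserving_on].

End ZSystem.

(* Main.v *)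
(** By König's lemma (nearest-neighbour steps make backward chains finitely
    branching) the origin is bi-infinite iff it has backward chains of every
    finite length, a measurable condition. Off an invariant null set, [T_alpha]
    maps [S_bi] onto itself, because the first point of a backward chain is
    again bi-infinite. Moreover [T_alpha] translates each piece where the first
    step is constant, so it preserves the measure of any set on which it is
    injective. A measurable section of [T_alpha] on [S_bi] thus has the same
    finite measure as its image [S_bi]; hence it is all of [S_bi] up to a null
    set, which is to say that [T_alpha] is almost surely injective. *)
Require Import Defs.
From HB Require Import structures.
From mathcomp Require Import all_boot all_order all_algebra.
From mathcomp Require Import all_classical all_reals all_analysis.

Set Implicit Arguments.
Unset Strict Implicit.
Unset Printing Implicit Defensive.

Import Order.TTheory GRing.Theory Num.Theory.
Import numFieldNormedType.Exports.

Local Open Scope classical_set_scope.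
Local Open Scope ring_scope.

(** * Maps [T (a w) w] that translate by a point-dependent lattice vector *)

Section PiecewiseTranslation.
Context {disp : measure_display} {Omega : measurableType disp} {R : realType}.
Context {d : nat} {P : probability Omega R}.
Variables (T : lattice d -> Omega -> Omega) (T_mp : mp_lattice_action P T).

Lemma actKN (v : lattice d) : cancel (T v) (T (- v)).
Proof. by case: T_mp => T0 TD _ _ w; rewrite -TD addNr T0. Qed.

Lemma actNK (v : lattice d) : cancel (T (- v)) (T v).
Proof. by case: T_mp => T0 TD _ _ w; rewrite -TD addrN T0. Qed.

Lemma measurable_act_preimage (v : lattice d) (A : set Omega) :
  measurable A -> measurable (T v @^-1` A).
Proof.
by case: T_mp => _ _ mT _ mA; rewrite -[_ @^-1` _]setTI; apply: mT.
Qed.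

(** The lattice is countable, so all translates of a measurable null cover of [N] still have a null
    union, and translating only permutes them. Codes that decode to no vector fall back on the zero
    translate, which adds nothing new. *)
Lemma invariant_negligible_hull (N : set Omega) : P.-negligible N ->
  exists H : set Omega, [/\ measurable H, P H = 0%E, N `<=` H &
    forall z w, H (T z w) <-> H w].
Proof.
move=> [A [mA A0 NA]].
pose H := \bigcup_n T (odflt 0 (unpickle n)) @^-1` A.
have mH : measurable H.
  by apply: bigcupT_measurable => n; exact: measurable_act_preimage.
have HT z w : H (T z w) -> H w.
  move=> [n _ /= An]; exists (pickle (odflt 0 (unpickle n) + z)) => //=.
  by rewrite pickleK /=; case: T_mp => _ -> _ _.
exists H; split=> //.
- apply: measure_negligible => //; apply: negligible_bigcup => n.
  apply/negligibleP; first exact: measurable_act_preimage.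
  by rewrite -A0; case: T_mp => _ _ _; exact.
- move=> w /NA Aw; exists (pickle (0 : lattice d)) => //=.
  by rewrite pickleK /=; case: T_mp => -> _ _ _.
- move=> z w; split; first exact: HT.
  by rewrite -{1}(actKN z w); exact: HT.
Qed.

Variable a : Omega -> lattice d.
Let f w := T (a w) w.

(** Measurability of [a] is asked only on [S], since a first step is constrained only for walks that
    start in the random set. *)
Definition measurable_pieces (S : set Omega) :=
  forall B : set (lattice d), measurable (S `&` a @^-1` B).

Lemma measurable_piecesW (S : set Omega) : measurable_pieces S -> measurable S.
Proof. by move=> /(_ setT); rewrite preimage_setT setIT. Qed.

Lemma measurable_piecesS (S S' : set Omega) : S' `<=` S ->
  measurable S' -> measurable_pieces S -> measurable_pieces S'.
Proof.
move=> S'S mS' mS B; rewrite -(setIidl S'S) -setIA.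
exact: measurableI.
Qed.

Lemma measurable_piecewise_preimage (S E : set Omega) :
  measurable_pieces S -> measurable E -> measurable (S `&` f @^-1` E).
Proof.
move=> mS mE.
suff -> : S `&` f @^-1` E =
    \bigcup_v ((S `&` a @^-1` [set v]) `&` T v @^-1` E).
  apply: countable_bigcupT_measurable => [|v]; first exact: countableP.
  by apply: measurableI; [exact: mS | exact: measurable_act_preimage].
apply/seteqP; split=> w /=.
  by move=> [Sw Ew]; exists (a w).
by move=> [v _ [[Sw /= <-] Ew]].
Qed.

(** On the piece where [a] equals [v] the map is [T v], so the image of that piece is a preimage
    under the inverse [T (- v)]. *)
Lemma measurable_piecewise_image (S : set Omega) :
  measurable_pieces S -> measurable (f @` S).
Proof.
move=> mS.
suff -> : f @` S = \bigcup_v T (- v) @^-1` (S `&` a @^-1` [set v]).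
  apply: countable_bigcupT_measurable => [|v]; first exact: countableP.
  exact: measurable_act_preimage.
apply/seteqP; split=> w /=.
  by move=> [u Su <-]; exists (a u) => //=; rewrite actKN.
by move=> [v _ [/= Su av]]; exists (T (- v) w) => //; rewrite /f av actNK.
Qed.

(** Each piece keeps its measure under its translation, and injectivity keeps the images of distinct
    pieces disjoint, so countable additivity applies on both sides. *)
Lemma measure_piecewise_image (S : set Omega) : measurable_pieces S ->
  set_inj S f -> P (f @` S) = P S.
Proof.
move=> mS injf.
pose A n := S `&` a @^-1` [set v | pickle v = n].
have aA n w : A n w -> a w = odflt 0 (unpickle n).
  by move=> [_ /= <-]; rewrite pickleK.
have AS n : A n `<=` S by move=> w [].
have mA n : measurable_pieces (A n).
  by apply: (measurable_piecesS _ _ mS) => //; exact: mS.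
have tA : trivIset setT A.
  apply/trivIsetP => m n _ _ /eqP mn; apply/seteqP; split=> // w.
  by move=> [[_ /= am] [_ /= an]]; case: mn; rewrite -am; exact: an.
have tfA : trivIset setT (fun n => f @` A n).
  apply/trivIsetP => m n _ _ /eqP mn; apply/seteqP; split=> // w.
  move=> [[u Au <-] [u' Au' fu']]; case: mn.
  have uu' : u' = u by apply: injf => //; rewrite inE; apply: AS; eassumption.
  by case: Au => _ /= <-; case: Au' => _ /= <-; rewrite uu'.
have PA n : P (f @` A n) = P (A n).
  set v : lattice d := odflt 0 (unpickle n).
  case: T_mp => _ _ _ /(_ (- v) _ (measurable_piecesW (mA n))) <-.
  congr (P _); apply/seteqP; split=> w /=.
    by move=> [u Au <-]; rewrite /f (aA _ _ Au) actKN; exact: Au.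
  by move=> Au; exists (T (- v) w) => //; rewrite /f (aA _ _ Au) actNK.
have SA : S = \bigcup_n A n.
  apply/seteqP; split=> w; last by move=> [n _ /AS].
  by move=> Sw; exists (pickle (a w)).
rewrite {2}SA measure_semi_bigcup //; last 2 first.
- by move=> n; exact: measurable_piecesW.
- by rewrite -SA; exact: measurable_piecesW.
rewrite SA image_bigcup measure_semi_bigcup //; last 2 first.
- by move=> n; exact: measurable_piecewise_image.
- by apply: bigcupT_measurable => n; exact: measurable_piecewise_image.
by apply: eq_eseriesr => n _; exact: PA.
Qed.

(** In each fibre of [f] the point whose step has the least code is kept. It is unique: two points
    of a fibre with the same step have the same image under one invertible translation. *)
Lemma measurable_injective_section (S : set Omega) : measurable_pieces S ->
  exists S' : set Omega,
    [/\ measurable S', S' `<=` S, set_inj S' f & f @` S' = f @` S].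
Proof.
move=> mS.
pose S' := [set w | S w /\
  forall u, S u -> f u = f w -> (pickle (a w) <= pickle (a u))%N].
have S'S : S' `<=` S by move=> w [].
exists S'; split=> //.
(* [bad v] holds the points that lose to a point of their fibre with step [v]. Quantifying over
   steps instead of competing points leaves only a countable union. *)
- pose bad v := (S `&` a @^-1` [set x | (pickle v < pickle x)%N]) `&`
    (S `&` f @^-1` (f @` (S `&` a @^-1` [set v]))).
  suff -> : S' = S `\` \bigcup_v bad v.
    apply: measurableD; first exact: measurable_piecesW.
    apply: countable_bigcupT_measurable => [|v]; first exact: countableP.
    apply: measurableI; first exact: mS.
    apply: measurable_piecewise_preimage => //.
    apply: measurable_piecewise_image.
    by apply: (measurable_piecesS _ _ mS); [exact: subIsetl | exact: mS].
  apply/seteqP; split=> w.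
    move=> [Sw minw]; split=> // -[v _ [[_ /= va] [_ [u [Su /= av] fuw]]]].
    by have := minw u Su fuw; rewrite av leqNgt va.
  move=> [Sw nbad]; split=> // u Su fuw; rewrite leqNgt; apply/negP => lt_uw.
  by apply: nbad; exists (a u) => //; split; split=> //; exists u.
- move=> u w; rewrite !inE => -[Su minu] [Sw minw] fuw.
  have : pickle (a u) = pickle (a w).
    by apply/eqP; rewrite eqn_leq minu// minw.
  move=> /(pcan_inj pickleK) auw; move: fuw; rewrite /f auw.
  exact: (can_inj (actKN _)).
- apply/seteqP; split; first by apply: image_subset.
  move=> _ [w Sw <-].
  pose Q n := `[< exists2 u, S u & f u = f w /\ pickle (a u) = n >].
  have exQ : exists n, Q n by exists (pickle (a w)); apply/asboolP; exists w.
  case: (ex_minnP exQ) => n /asboolP[u Su [fuw <-]] minn.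
  exists u => //; split=> // x Sx fxu; apply: minn; apply/asboolP.
  by exists x => //; rewrite fxu.
Qed.

(* A section [S'] of [f] has the measure of its image, here [S] itself, so
   finiteness of [P] makes the points of [S] outside [S'] a null set. *)
Lemma piecewise_surjection_bijective_mod0 (S : set Omega) :
  measurable_pieces S -> f @` S = S ->
  exists S0 : set Omega,
    [/\ measurable S0, S0 `<=` S, P (S `\` S0) = 0%E & set_bij S0 S0 f].
Proof.
move=> mS fS; have [S' [mS' S'S injf fS']] := measurable_injective_section mS.
have PS' : P S' = P S.
  rewrite -(measure_piecewise_image (measurable_piecesS S'S mS' mS) injf).
  by rewrite fS' fS.
have mS1 := measurable_piecesW mS.
have negK : P.-negligible (S `\` S').
  apply/negligibleP; first exact: measurableD.
  rewrite measureD //; last by rewrite ltey_eq fin_num_measure.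
  rewrite (setIidr S'S).
  by have : (P S - P S' = 0)%E by rewrite PS' subee // fin_num_measure.
(* Removing an invariant null set, and not just the points outside the section, keeps [f] mapping
   the remainder onto itself. *)
have [H [mH H0 KH HT]] := invariant_negligible_hull negK.
have S0S' w : S w -> ~ H w -> S' w.
  by move=> Sw nH; apply: contrapT => nS'; apply/nH/KH.
exists (S `\` H); split.
- exact: measurableD.
- by move=> w [].
- apply: (subset_measure0 _ _ _ H0) => //.
    by apply: measurableD => //; exact: measurableD.
  by move=> w [Sw] nSH; apply: contrapT => nH; apply: nSH.
- split.
  + move=> w [Sw nH]; split; last by move=> /HT.
    by rewrite -fS; exists w.
  + move=> u w; rewrite !inE => -[Su nHu] [Sw nHw].
    by apply: injf; rewrite inE; exact: S0S'.
  + move=> w [Sw nH]; have [u Su fuw] : (f @` S) w by rewrite fS.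
    by exists u => //; split=> // Hu; apply: nH; rewrite -fuw; apply/HT.
Qed.

End PiecewiseTranslation.

(** * König's lemma *)

Lemma konig (A : eqType) (good : set (seq A)) :
    (forall s x, good (rcons s x) -> good s) ->
    (forall s, good s -> exists l : seq A, forall x, good (rcons s x) -> x \in l) ->
    (forall n, exists2 s, good s & size s = n) ->
  exists a : nat -> A, forall n, good (mkseq a n).
Proof.
move=> good_rcons branching long.
have good_cat s t : good (s ++ t) -> good s.
  elim/last_ind: t => [|t x IHt]; first by rewrite cats0.
  by rewrite -rcons_cat => /good_rcons.
(* Lists that have good extensions by every length: the property to be propagated along the
   branch. *)
pose ext s := forall n, exists2 t, good (s ++ t) & size t = n.
have ext_rcons s : ext s -> exists x, ext (rcons s x).
  move=> exts; have [t0 /good_cat/branching[l sl] _] := exts 0%N.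
  apply: contrapT => /forallNP next.
  (* If every next entry [x] were a dead end at some length [N x], an extension of [s] longer than
     the maximum of [N] over the finite list [l] would have a first entry in [l] and outlive its
     bound. *)
  have /choice[N badN] x :
      exists n, forall t, good (rcons s x ++ t) -> size t <> n.
    have /existsNP[n nP] := next x; exists n => t gt st.
    by apply: nP; exists t.
  have [[//|x t] gxt [szt]] := exts (\max_(x <- l) N x).+1.
  rewrite -cat_rcons in gxt.
  have xl : x \in l by apply/sl/good_cat/gxt.
  have le_N : (N x <= size t)%N by rewrite szt; apply: leq_bigmax_seq.
  apply: (badN x (take (N x) t)); last by rewrite size_takel.
  by apply: (@good_cat _ (drop (N x) t)); rewrite -catA cat_take_drop.
have ext0 : ext [::] by [].
have [x0 _] := ext_rcons _ ext0.
(* [x0] merely makes [next] total; it is used only at lists that cannot be prolonged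
   indefinitely. *)
have /choice[next nextP] s : exists x, ext s -> ext (rcons s x).
  have [/ext_rcons[x extx]|nexts] := pselect (ext s); first by exists x.
  by exists x0.
pose seqs n := iter n (fun s => rcons s (next s)) [::].
have seqsE n : mkseq (next \o seqs) n = seqs n.
  by elim: n => // n IHn; rewrite mkseqS IHn.
have ext_seqs n : ext (seqs n) by elim: n => //= n; exact: nextP.
exists (next \o seqs) => n; rewrite seqsE.
by have [t /good_cat] := ext_seqs n 0%N.
Qed.

(** * Finite backward chains and measurability of bi-infiniteness *)

Section BiInfinite.
Context {disp : measure_display} {Omega : measurableType disp} {d : nat}.
Variables (W : Omega -> set (lattice d)).
Variables (X : lattice d -> Omega -> nat -> lattice d).
Hypothesis X_nn : nearest_neighbor_walks W X.

(** A finite prefix of a sequence witnessing [bi_infinite]. The guard on [size s] admits the empty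
    prefix for every [z], as closure under prefixes requires. *)
Definition backward_chain (w : Omega) (z : lattice d) (s : seq (lattice d)) :=
  ((0 < size s)%N -> s`_0 = z) /\
  forall m, (m < size s)%N -> W w s`_m /\
    forall i, (1 <= m)%N && (i <= m)%N -> X s`_m w i = s`_(m - i).

Lemma backward_chain_rcons w z s x :
  backward_chain w z (rcons s x) -> backward_chain w z s.
Proof.
move=> [s0 sW]; split=> [s_gt0|m ms].
  by rewrite -s0 ?size_rcons// nth_rcons s_gt0.
have nth_s k : (k <= m)%N -> (rcons s x)`_k = s`_k.
  by move=> km; rewrite nth_rcons (leq_ltn_trans km ms).
have [] := sW m; first by rewrite size_rcons ltnS ltnW.
rewrite nth_s// => Wm Xm; split=> // i im.
by rewrite Xm// nth_s// leq_subr.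
Qed.

(** The walk from a new entry [x] reaches the last entry of [s] in one nearest-neighbour step, so
    [x] differs from it by one of finitely many unit vectors. *)
Lemma backward_chain_finitely_branching w z s : exists l : seq (lattice d),
  forall x, backward_chain w z (rcons s x) -> x \in l.
Proof.
case: (posnP (size s)) => [/size0nil ->|s_gt0].
  by exists [:: z] => x [/= -> //]; rewrite inE.
pose units : seq (lattice d) := [seq delta_mx 0 i | i <- enum 'I_d] ++
  [seq - delta_mx 0 i | i <- enum 'I_d].
exists [seq last 0 s - v | v <- units] => x [_].
move=> /(_ (size s)); rewrite size_rcons leqnn => /(_ isT).
rewrite nth_rcons ltnn eqxx => -[Wx /(_ 1%N)].
rewrite s_gt0 => /(_ isT) X1.
have {}X1 : X x w 1%N = last 0 s.
  by rewrite X1 nth_rcons ltn_subrL s_gt0 /= subn1 nth_last.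
have [X0 /(_ 0%N)] := X_nn Wx.
rewrite X0 X1 => -[i step]; apply/mapP; exists (last 0 s - x).
  rewrite mem_cat; apply/orP.
  by case: step => ->; [left|right]; apply/map_f; rewrite mem_enum.
by rewrite opprB addrC subrK.
Qed.

Lemma bi_infiniteP w z : bi_infinite W X w z <->
  forall n, exists2 s, backward_chain w z s & size s = n.
Proof.
split=> [[a [Wa a0 Xa]] n|long].
  exists (mkseq a n); last by rewrite size_mkseq.
  split; rewrite size_mkseq; first by move=> n_gt0; rewrite nth_mkseq.
  move=> m mn; rewrite nth_mkseq//; split=> // i /andP[m_gt0 im].
  by rewrite Xa// nth_mkseq// (leq_ltn_trans (leq_subr _ _)).
have [a aP] := konig (@backward_chain_rcons w z)
  (fun s _ => backward_chain_finitely_branching w z s) long.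
exists a; split.
- move=> n; have [_ /(_ n)] := aP n.+1.
  by rewrite size_mkseq ltnS leqnn nth_mkseq// => -[].
- by have [] := aP 1%N; rewrite nth_mkseq// => ->.
- move=> n i n_gt0 ni; have [_ /(_ n)] := aP n.+1.
  rewrite size_mkseq ltnS leqnn nth_mkseq// => -[]// _ /(_ i).
  by rewrite n_gt0 ni nth_mkseq ?ltnS ?leq_subr// => ->.
Qed.

Hypothesis W_meas : measurable_random_set W.
Hypothesis X_meas : measurable_walks W X.

Lemma measurable_imply (Q : Prop) (A : set Omega) :
  measurable A -> measurable [set w | Q -> A w].
Proof.
move=> mA; have [q|nq] := pselect Q.
  suff -> : [set w | Q -> A w] = A by [].
  by apply/seteqP; split=> w //=; apply.
suff -> : [set w | Q -> A w] = setT by [].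
by apply/seteqP; split=> w // _ /nq.
Qed.

Lemma measurable_backward_chain z s :
  measurable [set w | backward_chain w z s].
Proof.
have [s0|ns0] := pselect ((0 < size s)%N -> s`_0 = z); last first.
  suff -> : [set w | backward_chain w z s] = set0 by [].
  by apply/seteqP; split=> w // -[].
suff -> : [set w | backward_chain w z s] = \bigcap_m
    [set w | (m < size s)%N -> ([set u | W u s`_m] `&`
      \bigcap_i [set u | (1 <= m)%N && (i <= m)%N -> ([set v | W v s`_m] `&`
         (fun v => X s`_m v i) @^-1` [set s`_(m - i)]) u]) w].
  apply: bigcapT_measurable => m; apply: measurable_imply.
  apply: measurableI; first exact: W_meas.
  apply: bigcapT_measurable => i; apply: measurable_imply.
  exact: X_meas.
apply/seteqP; split=> w.
  move=> [_ sW] m _ /= /sW[Wm Xm]; split=> // i _ /= /Xm Xmi.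
  by split.
move=> sW; split=> // m ms; have [Wm Xm] := sW m I ms.
by split=> // i im; have [] := Xm i I im.
Qed.

Lemma measurable_S_bi : measurable (S_bi W X).
Proof.
(* Infinite sequences form an uncountable family, but tuples of a given length form a countable one,
   so the union over them is measurable. *)
suff -> : S_bi W X = [set w | W w 0] `&`
    \bigcap_n \bigcup_(s : n.-tuple (lattice d)) [set w | backward_chain w 0 s].
  apply: measurableI; first exact: W_meas.
  apply: bigcapT_measurable => n.
  apply: countable_bigcupT_measurable => [|s]; first exact: countableP.
  exact: measurable_backward_chain.
apply/seteqP; split=> w [W0].
  move=> /bi_infiniteP long; split=> // n _; have [s sP /eqP szs] := long n.
  by exists (Tuple szs).
move=> long; split=> //; apply/bi_infiniteP => n; have [s _ sP] := long n I.
by exists (tval s); rewrite ?size_tuple.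
Qed.

End BiInfinite.

(** * Action of [T_alpha] on [S_bi] at a configuration where the walk identities hold *)

Section Dynamics.
Context {disp : measure_display} {Omega : measurableType disp} {d : nat}.
Variables (T : lattice d -> Omega -> Omega).
Variables (W : Omega -> set (lattice d)) (W_cov : covariant_set T W).
Variables (X : lattice d -> Omega -> nat -> lattice d).
Hypothesis X_nn : nearest_neighbor_walks W X.

Variable w : Omega.
Hypothesis X_stat : forall z x k, W w z -> X z w k = x + X (z - x) (T x w) k.
Hypothesis X_comp : forall z k, W w z ->
  W w (X z w 1%N) /\ X z w k.+1 = X (X z w 1%N) w k.

Lemma bi_infinite_shift x z :
  bi_infinite W X w z -> bi_infinite W X (T x w) (z - x).
Proof.
move=> [a [Wa a0 Xa]]; exists (fun n => a n - x); split=> [n||n i n_gt0 ni].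
- by rewrite W_cov; exists (a n).
- by rewrite a0.
- by rewrite -Xa// (X_stat x)// [x + _]addrC addrK.
Qed.

Lemma bi_infinite_next z :
  W w z -> bi_infinite W X w z -> bi_infinite W X w (X z w 1%N).
Proof.
move=> Wz [a [Wa a0 Xa]].
(* The old backward chain is shifted by one index, with the next point of the walk placed in
   front. *)
exists (fun n => if n is m.+1 then a m else X z w 1%N); split=> //.
  by case=> [|n] //; have [] := X_comp 0%N Wz.
(* The walk from [a n] is at [z] after [n] steps, and by compatibility its following step is that of
   the walk from [z]. *)
have Xz n : X (a n) w n.+1 = X z w 1%N.
  elim: n => [|n IHn]; first by rewrite a0.
  have [_ ->] := X_comp n.+1 (Wa n.+1).
  by rewrite Xa// subn1.
move=> [|n] // i _; rewrite leq_eqVlt ltnS => /predU1P[->|ni].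
  by rewrite subnn Xz.
(* [bi_infinite] does not constrain the walk from [a 0]; its position at time zero comes from
   [X_nn]. *)
rewrite subSn//; case: n ni => [|n] ni; last by rewrite Xa.
by move: ni; rewrite leqn0 => /eqP ->; rewrite a0; have [] := X_nn Wz.
Qed.

Lemma bi_infinite_prev z : bi_infinite W X w z ->
  exists y, [/\ W w y, bi_infinite W X w y & X y w 1%N = z].
Proof.
move=> [a [Wa a0 Xa]]; exists (a 1%N); split=> //; last by rewrite Xa.
exists (fun n => a n.+1); split=> // n i n_gt0 ni.
by rewrite Xa ?subSn// leqW.
Qed.

Lemma T_alpha_stable : S_bi W X w -> S_bi W X (T_alpha T X w).
Proof.
move=> [W0 bi0]; split.
  by rewrite W_cov; exists (X 0 w 1%N); rewrite ?subrr//; have [] := X_comp 0 W0.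
rewrite -[X in bi_infinite _ _ _ X](subrr (X 0 w 1%N)).
by apply: bi_infinite_shift; exact: bi_infinite_next.
Qed.

Lemma T_alpha_onto : T 0 w = w -> (forall x y, T (x + y) w = T x (T y w)) ->
  S_bi W X w -> exists y, S_bi W X (T y w) /\ T_alpha T X (T y w) = w.
Proof.
move=> T0 TD [W0 bi0]; have [y [Wy biy Xy]] := bi_infinite_prev bi0.
exists y; split.
  split; first by rewrite W_cov; exists y; rewrite ?subrr.
  by rewrite -[X in bi_infinite _ _ _ X](subrr y); exact: bi_infinite_shift.
(* The walk from [y] steps to the origin, so by stationarity the first step seen from [T y w] is
   [- y], which undoes the translation. *)
rewrite /T_alpha; have := X_stat y 1 Wy; rewrite subrr Xy => /esym/addr0_eq <-.
by rewrite -TD addNr.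
Qed.

End Dynamics.

(** * The trace sigma-algebra and the assembly of the system *)

Lemma F_alphaE (disp : measure_display) (Omega : measurableType disp) (d : nat)
    (W : Omega -> set (lattice d)) (X : lattice d -> Omega -> nat -> lattice d)
    (E : set Omega) :
  measurable (S_bi W X) ->
  F_alpha W X E <-> measurable E /\ E `<=` S_bi W X.
Proof.
move=> mS; split=> [[A mA <-]|[mE ES]]; first by split; [exact: measurableI|].
by exists E => //; exact/setIidPl.
Qed.

Theorem theorem2p13 (disp : measure_display) (Omega : measurableType disp)
    (R : realType) (P : probability Omega R) (d : nat)
    (T : lattice d -> Omega -> Omega)
    (W : Omega -> set (lattice d))
    (X : lattice d -> Omega -> nat -> lattice d)
    (T_mp : mp_lattice_action P T)
    (W_meas : measurable_random_set W)
    (W_cov : covariant_set T W)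
    (W_pos : (0 < P [set w | W w 0%R])%E)
    (X_nn : nearest_neighbor_walks W X)
    (X_meas : measurable_walks W X)
    (X_stat : stationary_walks P T W X)
    (X_comp : compatible_walks P W X)
    (T_erg : ergodic_action P T)
    (X_loop : loop_free_walks P W X) :
  measurable (S_bi W X) /\
  mp_Z_system (S_bi W X) (F_alpha W X) (P_alpha P W X) (T_alpha T X).
Proof.
have mS := measurable_S_bi X_nn W_meas X_meas.
split=> //; set S := S_bi W X in mS *.
have FE E : F_alpha W X E <-> measurable E /\ E `<=` S by exact: F_alphaE.
have PE E : E `<=` S -> P_alpha P W X E = P E.
  by move=> ES; rewrite /P_alpha (setIidl ES).
pose a w := X 0 w 1%N.
have mpS : measurable_pieces a S.
  (* [X_meas] controls the first step only on the event that the origin lies in [W], and [S] is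
     contained in that event. *)
  move=> B; suff -> : S `&` a @^-1` B = S `&` ([set w | W w 0] `&` a @^-1` B).
    by apply: measurableI => //; exact: X_meas.
  by apply/seteqP; split=> w [Sw]; [case: (Sw) | case].
(* Outside [N] stationarity and compatibility hold at every point, and invariance of [N] lets them
   hold along the whole orbit. *)
have [N [mN PN badN NT]] :=
  invariant_negligible_hull T_mp (negligibleU X_stat X_comp).
have stat w : ~ N w ->
    forall z x k, W w z -> X z w k = x + X (z - x) (T x w) k.
  by move=> nN; apply: contrapT => nstat; apply: nN; apply: badN; left.
have comp w : ~ N w ->
    forall z k, W w z -> W w (X z w 1%N) /\ X z w k.+1 = X (X z w 1%N) w k.
  by move=> nN; apply: contrapT => ncomp; apply: nN; apply: badN; right.
have mpS1 : measurable_pieces a (S `\` N).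
  by apply: (measurable_piecesS _ _ mpS); [exact: subDsetl|exact: measurableD].
have fS1 : T_alpha T X @` (S `\` N) = S `\` N.
  apply/seteqP; split=> [_ [w [Sw nN] <-]|w [Sw nN]].
    split; last by move=> /NT.
    by apply: T_alpha_stable => //; [exact: stat|exact: comp].
  have [T0 TD _ _] := T_mp.
  have [y [Sy fy]] := T_alpha_onto W_cov (stat _ nN) (T0 w) (fun x y => TD x y w) Sw.
  by exists (T y w) => //; split=> // /NT.
have [S0 [mS0 S0S1 PS01 bijf]] :=
  piecewise_surjection_bijective_mod0 T_mp mpS1 fS1.
have S0S : S0 `<=` S by apply: subset_trans S0S1 _; exact: subDsetl.
have PS0 : P (S `\` S0) = 0%E.
  apply: (@subset_measure0 _ _ _ _ _ ((S `\` N) `\` S0 `|` N)).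
  - exact: measurableD.
  - by apply: measurableU => //; apply: measurableD => //; exact: measurableD.
  - by move=> w [Sw nS0]; have [Nw|nN] := pselect (N w); [right|left].
  - by apply: null_set_setU => //; apply: measurableD => //; exact: measurableD.
have P0 A : measurable A -> A `<=` S -> P A = P (S0 `&` A).
  move=> mA AS; rewrite (measureDI P mA mS0) setIC.
  rewrite [X in (X + _)%E](_ : _ = 0%E) ?add0e//.
  by apply: (subset_measure0 _ _ _ PS0); [exact: measurableD..|exact: setSD].
have mpS0 : measurable_pieces a S0 by exact: (measurable_piecesS S0S mS0 mpS).
split.
- split.
  + exact/sigma_algebra_strace/sigma_algebra_measurable.
  + by move=> A /FE[].
  + by rewrite PE// measure0.
  + by move=> A /FE[mA AS]; rewrite PE.
  + move=> A FA tA; have mA n : measurable (A n) by have /FE[] := FA n.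
    apply: (@measure_semi_sigma_additive _ _ _ (mrestr P mS)) => //.
    exact: bigcupT_measurable.
- exists S0; split=> //.
  + exact/FE.
  + by rewrite PE//; exact: subDsetl.
  + move=> E /FE[mE ES]; split; apply/FE; split.
    * exact: (measurable_piecewise_preimage T_mp mpS0).
    * by move=> w [/S0S].
    * apply: (@measurable_piecewise_image _ _ _ _ P _ T_mp a).
      apply: (measurable_piecesS _ _ mpS0); first exact: subIsetl.
      exact: measurableI.
    * by move=> _ [w [S0w _] <-]; apply: S0S; case: bijf => + _ _; exact.
- move=> E /FE[mE ES].
  have mf S' : measurable_pieces a S' ->
      measurable (S' `&` T_alpha T X @^-1` E).
    by move=> mpS'; exact: (measurable_piecewise_preimage T_mp).
  split; first by apply/FE; split; [exact: mf|exact: subIsetl].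
  (* Both sides are cut down to [S0] at no cost in measure. There [T_alpha] is a bijection, so it
     carries the preimage of [E] injectively onto [E] within [S0]. *)
  rewrite (PE _ (@subIsetl _ _ _)) PE// (P0 _ (mf _ mpS) (@subIsetl _ _ _)).
  rewrite (P0 E)// setIA (setIidl S0S).
  have [fS0 injf surjf] := bijf.
  rewrite -(@measure_piecewise_image _ _ _ _ P T T_mp a); last 2 first.
  + by apply: (measurable_piecesS _ _ mpS0); [exact: subIsetl|exact: mf].
  + by apply: sub_in2 injf => w; rewrite !inE => -[].
  congr (P _); apply/seteqP; split=> w.
    by move=> [u [S0u Eu] <-]; split=> //; exact: fS0.
  by move=> [/surjf[u S0u fu] Ew]; exists u; rewrite // -fu in Ew *.
Qed.
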